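(* Let $I\subset\mathbb{R}$ be an interval with $0\in I$. Suppose $\phi_{\tau,t}$ is generated by a time-dependent vector field of the form $(1,H_t)^T$ on $\mathbb{R}^+\times\Omega$, where $H_t$ has a formal $\tau$-series $H_t=\sum_{n\ge0}\frac{\tau^n}{n!}H_{n,t}$ on this region for all $\tau\in I$. Then $$\pi\circ\phi_{\tau,t}\circ\mathcal{I}_t=\mathrm{Id}_{\mathbb{R}^N}+\mathcal{T}_{H_t}(\tau)\cdot H_t\quad\text{on }I\times\mathbb{R}^+\times\Omega .$$
   Context: $\Omega\subset\mathbb{R}^N$ open. $\pi(t,x)=x$, $\mathcal{I}_t(x)=(t,x)$. For fixed $t$, $\phi_{\tau,t}$ is the flow in $\tau$ (with $\phi_{0,t}=\mathrm{Id}$) of $\frac{d\phi}{d\tau}=(1,H_t)^T\circ\phi$, whose first component evolves as $\tau$ and whose remaining components solve $\frac{d\xi}{d\tau}=H_t(\tau,\xi)$. $H_t$-transformation: for time-dependent vector fields $F_t=\sum_n\frac{\tau^n}{n!}F_{n,t}$ and $H_t=\sum_n\frac{\tau^n}{n!}H_{n,t}$ on $\mathbb{R}^N$ (formal $\tau$-series), define recursively $F^{[0]}_n=F_{n,t}$ and $F^{[i+1]}_n=F^{[i]}_{n+1}+\sum_{k=0}^nC_n^k\,D_\xi F^{[i]}_k\cdot H_{n-k,t}$ for $i\ge0$ ($C_n^k$ binomial coefficients, $D_\xi$ Jacobian in $\xi$), and set $\mathcal{T}_{H_t}(\tau)\cdot F_t=\sum_{n\ge0}\frac{\tau^{n+1}}{(n+1)!}F^{[n]}_{0,t}$.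 The identity is an identity of formal series in $\tau$. *)

(* Defs.v *)
From HB Require Import structures.
From mathcomp Require Import all_boot all_order all_algebra.
From mathcomp Require Import all_classical all_reals all_analysis.
Set Implicit Arguments. Unset Strict Implicit. Unset Printing Implicit Defensive.
Import Order.TTheory GRing.Theory Num.Theory.
Import numFieldNormedType.Exports.
Local Open Scope classical_set_scope.
Local Open Scope ring_scope.

Fixpoint iter_derive (R : realType) (V W : normedModType R)
    (vs : seq V) (f : V -> W) : V -> W :=
  match vs with
  | [::] => f
  | v :: vs' => fun x => 'D_v (iter_derive vs' f) x
  end.

Definition smooth_on (R : realType) (V W : normedModType R)
    (U : set V) (f : V -> W) : Prop :=
  forall (vs : seq V) (x : V), U x -> differentiable (iter_derive vs f) x.

Definition has_deriv_within (R : realType) (V : normedModType R)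
    (I : set R) (f : R -> V) (tau : R) (d : V) : Prop :=
  (fun h : R => h^-1 *: (f (tau + h) - f tau))
    @ within (fun h => I (tau + h)) (0 : R)^' --> d.

Definition tcoef (R : realType) (N : nat)
    (Ht : R -> 'rV[R]_N -> 'rV[R]_N) (n : nat) : 'rV[R]_N -> 'rV[R]_N :=
  fun xi => derive1n n (fun tau => Ht tau xi) 0.

Fixpoint Ftrans (R : realType) (N : nat)
    (F Hc : nat -> 'rV[R]_N -> 'rV[R]_N) (i : nat) :
    nat -> 'rV[R]_N -> 'rV[R]_N :=
  match i with
  | 0 => F
  | i'.+1 => fun n xi =>
      Ftrans F Hc i' n.+1 xi
      + \sum_(0 <= k < n.+1)
          ('D_(Hc (n - k)%N xi) (Ftrans F Hc i' k) xi) *+ 'C(n, k)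
  end.

Definition Tpartial (R : realType) (N : nat)
    (F Hc : nat -> 'rV[R]_N -> 'rV[R]_N) (n : nat) (tau : R)
    (xi : 'rV[R]_N) : 'rV[R]_N :=
  xi + \sum_(k < n) ((tau ^+ k.+1 / (k.+1)`!%:R) *: Ftrans F Hc k 0%N xi).

(* Main.v *)
(** Let [G 0 = H] and [G (i+1) = d/dtau (G i) + (D_xi (G i)) . H]. Along a
    trajectory the chain rule gives [xi^(i+1)(tau) = G i (tau, xi tau)], so the
    expansion of [xi] at [0] is its one-sided Taylor expansion, whose
    coefficients are the [G i (0, x)]. The recursion defining [F^[i]_n] is the
    Leibniz rule for the [n]-th [tau]-derivative of [G (i+1)] at [tau = 0], once
    [tau]-derivatives are commuted with the derivatives in [xi] by Schwarz's
    theorem; hence [F^[i]_n = d^n/dtau^n (G i) (0, .)]. *)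

Require Import Defs.
From HB Require Import structures.
From mathcomp Require Import all_boot all_order all_algebra.
From mathcomp Require Import all_classical all_reals all_analysis.
From mathcomp Require Import ring.
Import Order.TTheory GRing.Theory Num.Theory.
Import numFieldNormedType.Exports.
Local Open Scope classical_set_scope.
Local Open Scope ring_scope.
Set Implicit Arguments. Unset Strict Implicit.

(** * Derivatives within a set *)

(** Multiplying the difference quotient by [b - a] removes the division; the estimate then holds
    trivially at [b = a], so no punctured neighbourhood remains. *)
Lemma has_deriv_withinP (R : realType) (V : normedModType R) (A : set R)
    (f : R -> V) (a : R) (d : V) :
  has_deriv_within A f a d <->
  forall e : R, 0 < e -> exists2 del : R, 0 < del & forall b, A b -> `|b - a| < del ->
    `|f b - f a - (b - a) *: d| <= e * `|b - a|.
Proof.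
have key (b : R) : b - a != 0 ->
    `|f b - f a - (b - a) *: d| =
    `|d - (b - a)^-1 *: (f b - f a)| * `|b - a|.
  move=> ba0; rewrite mulrC -normrZ scalerBr scalerA divff // scale1r.
  by rewrite distrC.
rewrite /has_deriv_within; split.
  move=> /cvgrPdist_le h e e0; have := h e e0.
  rewrite /nbhs /= => /nbhs_ballP [del /= del0 hdel].
  exists del => // b Ab bd.
  have [/eqP|ba0] := eqVneq (b - a) 0.
    rewrite subr_eq0 => /eqP ->.
    by rewrite !subrr scale0r subr0 !normr0 mulr0.
  rewrite key // ler_pM2r ?normr_gt0 //.
  have := hdel (b - a); rewrite /ball /= sub0r normrN (addrC a) subrK; exact.
move=> h; apply/cvgrPdist_le => e e0; have [del del0 hdel] := h e e0.
rewrite /nbhs /=; apply/nbhs_ballP; exists del => //= b.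
rewrite /ball /= sub0r normrN => bd b0 Ab.
have := hdel _ Ab; rewrite key (addrC a b) addrK // => /(_ bd).
by rewrite ler_pM2r ?normr_gt0 // .
Qed.

Lemma differentiable_dist (R : realType) (V W : normedModType R) (f : V -> W)
    (x : V) : differentiable f x ->
  forall e : R, 0 < e -> exists2 del : R, 0 < del & forall h, `|h| < del ->
    `|f (x + h) - f x - 'd f x h| <= e * `|h|.
Proof.
move=> /diff_locallyxC h e e0.
have /eqaddoP /(_ e e0) := funext h.
move=> /nbhs_norm0P [del /= del0 hdel]; exists del => // v vd.
have := hdel v vd.
by rewrite /= opprD addrA.
Qed.

(** Inside the segment the derivative within it is the ordinary one, and at the endpoints it still
    gives continuity; this is what the mean value theorem asks for. *)
Lemma derivative_within_le (R : realType) (f f' : R -> R) (a b M : R) :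
  a <= b ->
  (forall x, x \in `[a, b] -> has_deriv_within [set` `[a, b]] f x (f' x)) ->
  (forall x, x \in `[a, b] -> `|f' x| <= M) ->
  `|f b - f a| <= M * (b - a).
Proof.
move=> ab fd fM.
have [c cab ->] : exists2 c, c \in `[a, b]%R & f b - f a = f' c * (b - a).
  apply: MVT_segment => //.
    move=> x xab.
    have xab' : x \in `[a, b] by exact: subset_itv_oo_cc.
    suff h : (fun h : R => h^-1 *: ((f \o shift x) (h *: 1) - f x)) @ 0^' --> f' x.
      apply: DeriveDef; first by apply/cvg_ex; exists (f' x).
      exact/cvg_lim.
    apply/cvgrPdist_le => e e0.
    have /has_deriv_withinP /(_ e e0) [d d0 hd] := fd x xab'.
    have : nbhs x [set` `]a, b[] by apply: near_in_itvoo.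
    move=> /nbhs_ballP [r /= r0 hr].
    apply/nbhs_ballP; exists (Num.min d r); first by rewrite /= lt_min d0.
    move=> h; rewrite /ball /= sub0r normrN lt_min => /andP[h1 h2] h0.
    have /hd : [set` `[a, b]] (x + h).
      apply: subset_itv_oo_cc; apply: hr.
      by rewrite /ball /= opprD addNKr normrN.
    rewrite (addrC x h) addrK => /(_ h1) h3.
    rewrite -(ler_pM2r (x := `|h|)) ?normr_gt0 // -normrM.
    rewrite scaler1 mulrC mulrBr mulrA divff // mul1r distrC.
    done.
  apply/subspace_continuousP => x xab.
  apply/cvgrPdist_le => e e0.
  have /has_deriv_withinP /(_ 1 ltr01) [d d0 hd] := fd x xab.
  (* The derivative estimate with error 1 bounds the increment by [K] times the distance, whence the
     radius [e / K]. *)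
  pose K := 1 + `|f' x|.
  have K0 : 0 < K by rewrite ltr_pwDl.
  rewrite /nbhs /=; apply/nbhs_ballP; exists (Num.min d (e / K)).
    by rewrite /= lt_min d0 divr_gt0.
  move=> y; rewrite /ball /= lt_min distrC => /andP[y1 y2] yab.
  have := hd y yab y1 => h.
  rewrite distrC -(subrK ((y - x) *: f' x) (f y - f x)).
  apply: le_trans (ler_normD _ _) _.
  rewrite ltr_pdivlMr // in y2.
  apply: le_trans (ltW y2).
  rewrite mulrDr mulr1 lerD //; last by rewrite normrM.
  by rewrite mul1r in h.
by rewrite normrM (ger0_norm (x := b - a)) ?subr_ge0 // ler_wpM2r ?subr_ge0 // fM.
Qed.

Lemma rV_norm_le (R : realType) (N : nat) (u : 'rV[R]_N) (c : R) :
  0 <= c -> (forall j, `|u 0 j| <= c) -> `|u| <= c.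
Proof.
move=> c0 h; rewrite [leLHS]/Num.Def.normr/= mx_normrE bigmax_le// => -[i j] _.
by rewrite /= ord1.
Qed.

Lemma le_rV_norm (R : realType) (N : nat) (u : 'rV[R]_N) j : `|u 0 j| <= `|u|.
Proof. by rewrite [leRHS]/Num.Def.normr/= mx_normrE; exact: (le_bigmax _ _ (0, j)). Qed.

Lemma has_deriv_within_coord (R : realType) (N : nat) (A : set R)
    (f : R -> 'rV[R]_N) a d j :
  has_deriv_within A f a d -> has_deriv_within A (fun s => f s 0 j) a (d 0 j).
Proof.
move=> /has_deriv_withinP h; apply/has_deriv_withinP => e /h[del del0 hd].
exists del => // b Ab /(hd _ Ab); apply: le_trans.
by have := le_rV_norm (f b - f a - (b - a) *: d) j; rewrite !mxE.
Qed.

(** The mean value equality fails for vectors, but the norm of a row is the maximum over its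
    coordinates, so the scalar inequality applies to each with the same [M]. *)
Lemma derivative_within_le_rV (R : realType) (N : nat) (f f' : R -> 'rV[R]_N)
    (a b M : R) :
  a <= b ->
  (forall x, x \in `[a, b] -> has_deriv_within [set` `[a, b]] f x (f' x)) ->
  (forall x, x \in `[a, b] -> `|f' x| <= M) ->
  `|f b - f a| <= M * (b - a).
Proof.
move=> ab fd fM; apply: rV_norm_le.
  rewrite mulr_ge0 ?subr_ge0 // (le_trans _ (fM a _)) //.
  by rewrite in_itv /= lexx.
move=> j; rewrite !mxE.
apply: (derivative_within_le (f := fun s => f s 0 j) (f' := fun s => f' s 0 j)) => //.
- by move=> x xab; exact/has_deriv_within_coord/fd.
- by move=> x xab; exact: le_trans (le_rV_norm _ _) (fM x xab).
Qed.

(** * Calculus rules and Taylor expansion within a set *)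

Lemma has_deriv_within_subset (R : realType) (V : normedModType R) (A B : set R)
    (f : R -> V) a d :
  A `<=` B -> has_deriv_within B f a d -> has_deriv_within A f a d.
Proof.
move=> AB /has_deriv_withinP h; apply/has_deriv_withinP => e /h[del del0 hd].
by exists del => // b /AB; exact: hd.
Qed.

Lemma has_deriv_withinB (R : realType) (V : normedModType R) (A : set R)
    (f g : R -> V) a df dg :
  has_deriv_within A f a df -> has_deriv_within A g a dg ->
  has_deriv_within A (fun s => f s - g s) a (df - dg).
Proof.
move=> hf hg; rewrite /has_deriv_within.
rewrite [X in X @ _](_ : _ = (fun h => h^-1 *: (f (a + h) - f a))
  \- (fun h => h^-1 *: (g (a + h) - g a))); first exact: cvgB.
by apply/funext => h /=; rewrite -scalerBr !opprD addrACA.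
Qed.

Lemma has_deriv_within_derive (R : realType) (V : normedModType R) (A : set R)
    (f : R -> V) (a : R) (d : V) : is_derive a (1 : R) f d -> has_deriv_within A f a d.
Proof.
move=> [fd <-]; rewrite /has_deriv_within.
apply: (@cvg_trans _ ((fun h : R => h^-1 *: ((f \o shift a) (h *: 1) - f a)) @ 0^')).
  rewrite (_ : (fun h : R => h^-1 *: (f (a + h) - f a)) =
    (fun h : R => h^-1 *: ((f \o shift a) (h *: 1) - f a))).
    exact/cvg_app/cvg_within.
  by apply/funext => h /=; rewrite /shift scaler1 (addrC a).
exact: fd.
Qed.

Lemma has_deriv_within_scalel (R : realType) (V : normedModType R) (A : set R)
    (f : R -> R) (v : V) a d :
  has_deriv_within A f a d -> has_deriv_within A (fun s => f s *: v) a (d *: v).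
Proof.
move=> hf; rewrite /has_deriv_within.
rewrite [X in X @ _](_ : _ = (fun h => (h^-1 *: (f (a + h) - f a)) *: v)).
  exact: cvgZr_tmp.
by apply/funext => h /=; rewrite -scalerBl scalerA.
Qed.

(** Normalising by the factorial turns differentiation into an index shift, so Taylor polynomials
    differentiate to Taylor polynomials. *)
Lemma has_deriv_within_expr_fact (R : realType) (A : set R) (k : nat) (a : R) :
  has_deriv_within A (fun s => s ^+ k / k`!%:R : R) a
    (if k is j.+1 then a ^+ j / j`!%:R else 0).
Proof.
case: k => [|k].
  apply/has_deriv_withinP => e e0; exists 1 => // b _ _.
  by rewrite !expr0 subrr scaler0 subr0 normr0 mulr_ge0 ?(ltW e0).
rewrite (_ : a ^+ k / k`!%:R = ((k.+1%:R * a ^+ k) *: 1) *: (k.+1`!%:R)^-1 :> R).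
  apply: (has_deriv_within_scalel (f := fun s => s ^+ k.+1)).
  apply: has_deriv_within_derive. 
    have := @is_deriveX R R id k.+1 a 1 1 (is_derive_id _ _).
    by rewrite fctE.
by rewrite factS natrM invfM /GRing.scale /= mulr1 mulrACA divff ?pnatr_eq0 // mul1r.
Qed.

Lemma has_deriv_within_sum (R : realType) (V : normedModType R) (A : set R) n
    (f : nat -> R -> V) a (d : nat -> V) :
  (forall k, has_deriv_within A (f k) a (d k)) ->
  has_deriv_within A (fun s => \sum_(k < n) f k s) a (\sum_(k < n) d k).
Proof.
move=> h; rewrite /has_deriv_within.
rewrite [X in X @ _](_ : _ = (fun x => \sum_(k < n) x^-1 *: (f k (a + x) - f k a))).
  by apply: cvg_big => [|k _]; [exact: add_continuous | exact: h].
by apply/funext => x /=; rewrite -sumrB scaler_sumr.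
Qed.

(** Lifts a trajectory to space-time, so that the chain rule applies to functions of time and
    position together. *)
Lemma has_deriv_within_pair (R : realType) (V : normedModType R) (A : set R)
    (f : R -> V) a d :
  has_deriv_within A f a d ->
  has_deriv_within A (fun s => (s, f s) : R * V) a (1, d).
Proof.
move=> /has_deriv_withinP h; apply/has_deriv_withinP => e e0.
have [del del0 hd] := h e e0; exists del => // b Ab bd.
rewrite prod_normE /= scaler1 addrN normr0 ge_max mulr_ge0 ?(ltW e0) //=.
exact: hd.
Qed.

(** The error splits into the remainder of [G] at [f a] and the image of the remainder of [f] under
    the differential, which is Lipschitz because it is linear and continuous. *)
Lemma has_deriv_within_comp (R : realType) (V W : normedModType R) (A : set R)
    (f : R -> V) (G : V -> W) a d :
  differentiable G (f a) -> has_deriv_within A f a d ->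
  has_deriv_within A (fun s => G (f s)) a ('d G (f a) d).
Proof.
move=> Gd /has_deriv_withinP fd; apply/has_deriv_withinP => e e0.
have [k k0 hk] := linear_lipschitz (diff_continuous Gd).
have K0 : 0 < 1 + `|d| by rewrite ltr_pwDl.
set K := 1 + `|d| in K0.
have [d1 d10 h1] := fd (e / 2 / k) ltac:(by rewrite !divr_gt0).
have [d2 d20 h2] := fd 1 ltr01.
have [d3 d30 h3] := differentiable_dist Gd (e := e / 2 / K) ltac:(by rewrite !divr_gt0).
(* [d1] controls the remainder of [f], [d2] bounds the increment of [f] by [K] times that of the
   variable, and [d3 / K] then keeps [f b] within [d3] of [f a]. *)
exists (Num.min (Num.min d1 d2) (d3 / K)).
  by rewrite !lt_min d10 d20 divr_gt0.
move=> b Ab; rewrite !lt_min ltr_pdivlMr // => /andP[/andP[b1 b2] b3].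
have fK : `|f b - f a| <= `|b - a| * K.
  rewrite -(subrK ((b - a) *: d) (f b - f a)).
  apply: le_trans (ler_normD _ _) _.
  rewrite mulrDr mulr1 lerD //; last by rewrite normrZ.
  by rewrite -[leRHS]mul1r h2.
have := h3 _ (le_lt_trans fK b3); rewrite subrKC => h4.
have := le_trans (hk _) (ler_wpM2l (ltW k0) (h1 b Ab b1)).
rewrite (linearB ('d G (f a)) (f b - f a)) linearZ /= => h5.
rewrite -(subrK ('d G (f a) (f b - f a)) (G (f b) - G (f a))) -addrA.
apply: le_trans (ler_normD _ _) _.
rewrite [e]splitr mulrDl lerD //.
  apply: le_trans h4 _.
  rewrite -mulrA ler_wpM2l ?divr_ge0 ?(ltW e0) // ler_pdivrMl //.
  by rewrite mulrC.
apply: le_trans h5 _.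
by rewrite mulrA (mulrC k) divfK ?gt_eqF.
Qed.

(* Induction on [n]: the remainder of order [n+1] vanishes at [0] and its
   derivative is the remainder of order [n] of [y i.+1]. *)
Lemma taylor_peano_within (R : realType) (N : nat) (I : interval R)
    (y : nat -> R -> 'rV[R]_N) :
  0 \in I ->
  (forall i tau, tau \in I ->
     has_deriv_within [set s | s \in I] (y i) tau (y i.+1 tau)) ->
  forall n i (eps : R), 0 < eps -> exists2 delta : R, 0 < delta &
    forall tau, tau \in I -> `|tau| < delta ->
      `|y i tau - \sum_(k < n.+1) (tau ^+ k / k`!%:R) *: y (i + k)%N 0|
        <= eps * `|tau| ^+ n.
Proof.
move=> I0 yd; elim=> [|n IH] i eps e0.
  (* At order 0 the claim is continuity of [y i] at 0, deduced from its differentiability there. *)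
  have /has_deriv_withinP /(_ 1 ltr01) [d d0 hd] := yd i 0 I0.
  have K0 : 0 < 1 + `|y i.+1 0| by rewrite ltr_pwDl.
  exists (Num.min d (eps / (1 + `|y i.+1 0|))); first by rewrite lt_min d0 divr_gt0.
  move=> tau tauI; rewrite lt_min ltr_pdivlMr // => /andP[t1 t2].
  have := hd tau tauI; rewrite subr0 => /(_ t1) h.
  rewrite big_ord1 expr0 fact0 divr1 scale1r addn0 mulr1.
  rewrite -(subrK (tau *: y i.+1 0) (y i tau - y i 0)).
  apply: le_trans (ler_normD _ _) (le_trans _ (ltW t2)).
  by rewrite mulrDr mulr1 lerD ?normrZ // -[leRHS]mul1r.
have [d d0 hd] := IH i.+1 eps e0.
exists d => // tau tauI taud.
(* [dp] is the derivative of the normalised power; its vanishing at [k = 0] lines up the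
   differentiated sum of [n.+2] terms with that of [n.+1]. *)
pose dp (k : nat) (s : R) : R := if k is j.+1 then s ^+ j / j`!%:R else 0.
pose g s := y i s - \sum_(k < n.+2) (s ^+ k / k`!%:R) *: y (i + k)%N 0.
pose g' s := y i.+1 s - \sum_(k < n.+1) (s ^+ k / k`!%:R) *: y (i.+1 + k)%N 0.
have gd s : s \in I -> has_deriv_within [set s | s \in I] g s (g' s).
  move=> sI; apply: has_deriv_withinB; first exact: yd.
  rewrite [X in has_deriv_within _ _ _ X](_ : _ = \sum_(k < n.+2)
    (dp k s *: y (i + k)%N 0)); last first.
    rewrite [RHS]big_ord_recl /dp /= scale0r add0r; apply: eq_bigr => k _.
    by rewrite /bump /= add1n addSnnS.
  apply: (has_deriv_within_sum (f := fun k s => (s ^+ k / k`!%:R) *: y (i + k)%N 0)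
    (d := fun k => dp k s *: y (i + k)%N 0)).
  move=> k; apply: has_deriv_within_scalel.
  exact: has_deriv_within_expr_fact.
have g0 : g 0 = 0.
  rewrite /g big_ord_recl big1 ?addr0; last first.
    by move=> k _; rewrite /= /bump add1n exprS !mul0r scale0r.
  by rewrite expr0 fact0 divr1 scale1r addn0 subrr.
have sub s u v : s \in `[u, v] -> u \in I -> v \in I -> s \in I.
  rewrite in_itv /= => /andP[us sv] uI vI.
  by apply: (interval_is_interval uI vI); rewrite us sv.
have g'le s u v : u \in I -> v \in I -> `|u| <= `|tau| -> `|v| <= `|tau| ->
    s \in `[u, v] -> `|g' s| <= eps * `|tau| ^+ n.
  move=> uI vI ut vt suv.
  have st : `|s| <= `|tau|.
    move: suv ut vt; rewrite in_itv /= !ler_norml => /andP[us sv].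
    move=> /andP[u1 u2] /andP[v1 v2].
    by rewrite (le_trans u1 us) (le_trans sv v2).
  apply: le_trans (hd s (sub _ _ _ suv uI vI) (le_lt_trans st taud)) _.
  by rewrite ler_wpM2l ?(ltW e0) // lerXn2r ?nnegrE.
have main u v : u <= v -> u \in I -> v \in I -> `|u| <= `|tau| -> `|v| <= `|tau| ->
    `|g v - g u| <= eps * `|tau| ^+ n * (v - u).
  move=> uv uI vI ut vt.
  apply: derivative_within_le_rV => //; last by move=> s; exact: g'le.
  move=> s suv; apply: has_deriv_within_subset (gd s (sub _ _ _ suv uI vI)).
  by move=> z /= zuv; exact: sub zuv uI vI.
rewrite -/(g tau) exprSr mulrA.
(* The mean value inequality needs ordered endpoints, so the two signs of [tau] are treated
   separately. *)
have [t0|t0] := leP 0 tau.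
  have := main 0 tau t0 I0 tauI; rewrite normr0 g0 !subr0 (ger0_norm t0); exact.
have := main tau 0 (ltW t0) tauI I0.
by rewrite normr0 g0 !sub0r normrN (ltr0_norm t0); apply; rewrite // oppr_ge0 ltW.
Qed.

(** * Symmetry of second derivatives *)

Lemma open_norm_ball (R : realType) (V : normedModType R) (U : set V) (x : V) :
  open U -> U x -> exists2 r : R, 0 < r & forall h, `|h| < r -> U (x + h).
Proof.
move=> oU Ux; have /nbhs_ballP[r /= r0 hr] : nbhs x U by exact: open_nbhs_nbhs.
exists r => // h hr'; apply: hr.
by rewrite -ball_normE /= opprD addNKr normrN.
Qed.

(* Mean value inequality for [s |-> f (x + s v + h w) - f (x + s v)] on [0, h]. *)
Lemma second_difference (R : realType) (V : normedModType R) (N : nat)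
    (U : set V) (f : V -> 'rV[R]_N) (x v w : V) :
  open U -> U x -> (forall y, U y -> differentiable f y) ->
  differentiable ('D_v f) x ->
  forall e : R, 0 < e -> exists2 del : R, 0 < del & forall h : R, 0 < h -> h < del ->
    `|f (x + h *: v + h *: w) - f (x + h *: v) - (f (x + h *: w) - f x)
      - (h * h) *: 'D_w ('D_v f) x| <= e * (h * h).
Proof.
move=> oU Ux fd fvd e e0.
(* For [0 <= s <= h] the displacements [s *: v] and [s *: v + h *: w] have norm at most [h * C]; the
   summand 1 keeps [C] positive. *)
pose C := `|v| + `|w| + 1.
have C0 : 0 < C by rewrite ltr_wpDl // addr_ge0.
have [r r0 hr] := open_norm_ball oU Ux.
have [d d0 hd] := differentiable_dist fvd (e := e / 2 / C) ltac:(by rewrite !divr_gt0).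
exists (Num.min r d / C); first by rewrite divr_gt0 // lt_min r0.
move=> h h0; rewrite ltr_pdivlMr // lt_min => /andP[hCr hCd].
have vle (s : R) : s \in `[0, h] -> `|s *: v| <= h * C.
  rewrite in_itv /= => /andP[s0 sh]; rewrite normrZ (ger0_norm s0).
  rewrite ler_pM // /C -addrA lerDl addr_ge0 //.
have vwle (s : R) : s \in `[0, h] -> `|s *: v + h *: w| <= h * C.
  rewrite in_itv /= => /andP[s0 sh]; apply: le_trans (ler_normD _ _) _.
  rewrite !normrZ (ger0_norm s0) (ger0_norm (ltW h0)) /C mulrDr mulr1 mulrDr.
  by rewrite -[leLHS]addr0 lerD ?(ltW h0) // lerD // ler_wpM2r.
rewrite deriveE //; set L := 'd _ x in hd *.
(* Subtracting the expected linear term makes [g'] a difference of two first-order remainders of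
   ['D_v f] at [x], each at most half of [e * h]. *)
pose g (s : R) := f (x + (s *: v + h *: w)) - f (x + s *: v) - (s * h) *: L w.
pose g' (s : R) := 'D_v f (x + (s *: v + h *: w)) - 'D_v f (x + s *: v) - h *: L w.
have line (z : V) s : has_deriv_within [set` `[0, h]] (fun s => x + (s *: v + z)) s v.
  apply/has_deriv_withinP => e1 e10; exists 1 => // b _ _.
  rewrite opprD addrACA subrr add0r opprD addrACA subrr addr0 -scalerBl subrr.
  by rewrite normr0 mulr_ge0 // ltW.
have gd s : s \in `[0, h] -> has_deriv_within [set` `[0, h]] g s (g' s).
  move=> sh; apply: has_deriv_withinB; first apply: has_deriv_withinB.
  - have fx : differentiable f (x + (s *: v + h *: w)).
      by apply/fd/hr/(le_lt_trans (vwle s sh)).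
    rewrite deriveE //.
    exact: (has_deriv_within_comp (f := fun s => x + (s *: v + h *: w))).
  - have fx : differentiable f (x + s *: v).
      by apply/fd/hr/(le_lt_trans (vle s sh)).
    rewrite deriveE //; apply: (has_deriv_within_comp (f := fun s => x + s *: v)) => //.
    have := line 0 s; rewrite (_ : (fun s => x + (s *: v + 0)) = fun s => x + s *: v) //.
    by apply/funext => z; rewrite addr0.
  - rewrite (_ : h = h *: 1); last by rewrite scaler1.
    apply: (has_deriv_within_scalel (f := fun s => s * (h *: 1))).
    apply/has_deriv_withinP => e1 e10; exists 1 => // b _ _.
    by rewrite -mulrBl subrr normr0 mulr_ge0 // ltW.
have g'le s : s \in `[0, h] -> `|g' s| <= e * h.
  move=> sh; have h1 := hd _ (le_lt_trans (vwle s sh) hCd).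
  have h2 := hd _ (le_lt_trans (vle s sh) hCd).
  rewrite (_ : g' s =
    ('D_v f (x + (s *: v + h *: w)) - 'D_v f x - L (s *: v + h *: w)) -
    ('D_v f (x + s *: v) - 'D_v f x - L (s *: v))); last first.
    have -> : L (s *: v + h *: w) = L (s *: v) + h *: L w by rewrite linearD [L (h *: w)]linearZ.
    rewrite /g'.
    by apply/rowP => j; rewrite !mxE; ring.
  apply: le_trans (ler_normB _ _) _.
  rewrite (_ : e * h = e / 2 / C * (h * C) + e / 2 / C * (h * C)).
    by rewrite lerD //; [apply: le_trans h1 _|apply: le_trans h2 _];
      rewrite ler_wpM2l ?divr_ge0 ?(ltW e0) ?(ltW C0) // ?vwle ?vle.
  by rewrite (mulrC h) mulrA divfK ?gt_eqF // -mulrDl -splitr.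
have := derivative_within_le_rV (ltW h0) gd g'le.
rewrite /g !scale0r mul0r scale0r addr0 add0r !subr0 mulrA addrA.
by rewrite addrAC (addrAC _ (- ((h * h) *: L w))).
Qed.

(** The triangle inequality through [p] bounds [h] times the distance of [a] and [b] by [2 * e * h];
    dividing by [h] leaves an arbitrarily small bound. *)
Lemma eq_scaled_close (R : realType) (W : normedModType R) (a b : W) :
  (forall e : R, 0 < e -> exists h : R, exists p : W,
     [/\ 0 < h, `|p - h *: a| <= e * h & `|p - h *: b| <= e * h]) -> a = b.
Proof.
move=> close; apply/eqP; rewrite -subr_eq0 -normr_le0; apply/ler_addgt0Pr => e e0.
have [h [p [h0 pa pb]]] := close (e / 2) (divr_gt0 e0 (ltr0n _ 2)).
rewrite add0r -(ler_pM2r h0) -[X in _ * X <= _](gtr0_norm h0) mulrC -normrZ.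
rewrite scalerBr [e]splitr mulrDl.
apply: le_trans (ler_distD p _ _) _.
by rewrite lerD // distrC.
Qed.

(** The second difference is symmetric in [v] and [w], and [second_difference] compares it, at scale
    [h * h], with either mixed derivative. *)
Lemma derive_swap (R : realType) (V : normedModType R) (N : nat)
    (U : set V) (f : V -> 'rV[R]_N) (x v w : V) :
  open U -> U x -> (forall y, U y -> differentiable f y) ->
  differentiable ('D_v f) x -> differentiable ('D_w f) x ->
  'D_w ('D_v f) x = 'D_v ('D_w f) x.
Proof.
move=> oU Ux fd fv fw; apply: eq_scaled_close => e e0.
have [d1 d10 h1] := second_difference w oU Ux fd fv e0.
have [d2 d20 h2] := second_difference v oU Ux fd fw e0.
have m0 : 0 < Num.min d1 d2 by rewrite lt_min d10.
pose h : R := Num.min d1 d2 / 2.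
have h0 : 0 < h by rewrite divr_gt0.
have : h < Num.min d1 d2 by rewrite /h ltr_pdivrMr // ltr_pMr // ltr1n.
rewrite lt_min => /andP[hd1 hd2].
exists (h * h).
exists (f (x + h *: v + h *: w) - f (x + h *: v) - (f (x + h *: w) - f x)).
split; [exact: mulr_gt0 | exact: h1 | ].
have := h2 h h0 hd2.
rewrite (_ : _ - f (x + h *: w) - _ =
    f (x + h *: v + h *: w) - f (x + h *: v) - (f (x + h *: w) - f x)) //.
rewrite (addrAC x) !opprB -!addrA; congr (_ + _).
by rewrite [LHS]addrC [RHS]addrCA addrA.
Qed.

(** * Smooth maps *)

(** [U] contains a ball around [x], so the first-order expansion of [f] is also one of [g], and
    uniqueness of the differential identifies ['d g x] with ['d f x]. *)
Lemma differentiable_eq_on (R : realType) (V W : normedModType R) (U : set V)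
    (f g : V -> W) (x : V) :
  open U -> U x -> (forall y, U y -> f y = g y) ->
  differentiable f x -> differentiable g x.
Proof.
move=> oU Ux fg fx.
have key : g \o shift x = cst (g x) + 'd f x +o_ (0 : V) id.
  apply/eqaddoP => e e0; apply/nbhs_norm0P.
  have [d d0 hd] := differentiable_dist fx e0.
  have [r r0 hr] := open_norm_ball oU Ux.
  exists (Num.min d r); first by rewrite /= lt_min d0.
  move=> h; rewrite /= lt_min => /andP[h1 h2].
  have := hd h h1; rewrite !fg //; last exact: hr.
  by rewrite /shift /= !fctE /= (addrC x) opprD addrA.
apply/diff_locallyP; rewrite (diff_unique _ key) //.
  by split => //; exact: diff_continuous.
exact: diff_continuous.
Qed.

Lemma scale_is_bilinear (R : realType) (W : normedModType R) :
  bilinear_for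
    (GRing.Scale.Law.clone _ _ *:%R _) (GRing.Scale.Law.clone _ _ *:%R _)
    (@GRing.scale R W).
Proof.
split=> [u'|u] a x y /=.
- by rewrite scalerDl scalerA.
- by rewrite scalerDr !scalerA mulrC.
Qed.

(** The product rule, read off from the continuous bilinear map [(c, w) |-> c *: w] composed with
    the pair [(k, f)]. *)
Lemma is_diff_scale (R : realType) (V W : normedModType R) (k : V -> R)
    (f : V -> W) (x : V) :
  differentiable k x -> differentiable f x ->
  is_diff x (fun y => k y *: f y)
    (fun v => k x *: 'd f x v + 'd k x v *: f x).
Proof.
move=> kx fx.
pose B := bilinear_isBilinear.Build R R W W _ _ (@GRing.scale R W) (@scale_is_bilinear R W).
pose S : {bilinear R -> W -> W} := HB.pack (@GRing.scale R W) B.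
have Sc : continuous (fun p : R * W => S p.1 p.2) by exact: scale_continuous.
have kf := differentiable_pair kx fx.
have Sd := differentiable_bilin (k x, f x) Sc.
have -> : (fun y => k y *: f y) = (fun p : R * W => S p.1 p.2) \o (fun y => (k y, f y)) by [].
apply: DiffDef; first exact: differentiable_comp.
by rewrite diff_comp // diff_bilin // diff_pair.
Qed.

Lemma derive_eq_on (R : realType) (V W : normedModType R) (U : set V)
    (f g : V -> W) (v x : V) :
  open U -> U x -> (forall y, U y -> f y = g y) -> 'D_v f x = 'D_v g x.
Proof.
move=> oU Ux fg; apply: near_eq_derive.
by apply: filterS (open_nbhs_nbhs (conj oU Ux)) => y; exact: fg.
Qed.

(** Smoothness graded by order, the innermost derivative being peeled off first, so that closure
    properties follow by induction on [n] with [f] general. Order 0 already means differentiable. *)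
Fixpoint Cdiff (R : realType) (V W : normedModType R) (U : set V) (n : nat)
    (f : V -> W) : Prop :=
  (forall x, U x -> differentiable f x) /\
  (if n is m.+1 then forall v, Cdiff U m ('D_v f) else True).

Definition Cinf (R : realType) (V W : normedModType R) (U : set V)
    (f : V -> W) : Prop := forall n, Cdiff U n f.

(** [iter_derive] applies the head of the list last; the derivative that [Cdiff] peels off is the
    one at the end. *)
Lemma iter_derive_rcons (R : realType) (V W : normedModType R) (f : V -> W) vs v :
  iter_derive (rcons vs v) f = iter_derive vs ('D_v f).
Proof. by elim: vs => //= u vs ->. Qed.

Lemma smooth_on_Cinf (R : realType) (V W : normedModType R) (U : set V)
  (f : V -> W) : smooth_on U f -> Cinf U f.
Proof.
move=> + n; elim: n f => [|n IH] f fs; split=> //; try exact: (fs [::]).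
by move=> v; apply: IH => vs x Ux; rewrite -iter_derive_rcons; exact: fs.
Qed.

Section Cinf.
Context (R : realType) (V W : normedModType R) (U : set V).
Context (oU : open U).
Implicit Types (f g : V -> W) (k : V -> R).

Lemma Cdiff_diff n f x : Cdiff U n f -> U x -> differentiable f x.
Proof. by case: n => [|n] [h _]; exact: h. Qed.

Lemma Cinf_diff f x : Cinf U f -> U x -> differentiable f x.
Proof. by move=> /(_ 0%N); exact: Cdiff_diff. Qed.

Lemma Cinf_derive f v : Cinf U f -> Cinf U ('D_v f).
Proof. by move=> fs n; have [_] := fs n.+1; exact. Qed.

Lemma CdiffS n f : Cdiff U n.+1 f -> Cdiff U n f.
Proof.
elim: n f => [|n IH] f [fd fs]; split => // v; apply: IH; exact: fs.
Qed.

(** Formulas for derivatives hold only on [U]; since [U] is open and derivatives are local,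
    smoothness still passes through them. *)
Lemma Cdiff_eq_on n f g :
  (forall x, U x -> f x = g x) -> Cdiff U n f -> Cdiff U n g.
Proof.
elim: n f g => [|n IH] f g fg [fd fs]; split => //;
  try by move=> x Ux; apply: (differentiable_eq_on oU Ux fg); exact: fd.
by move=> v; apply: IH (fs v) => x Ux; exact: (derive_eq_on _ oU Ux fg).
Qed.

Lemma Cinf_eq_on f g : (forall x, U x -> f x = g x) -> Cinf U f -> Cinf U g.
Proof. by move=> fg fs n; exact: Cdiff_eq_on fg (fs n). Qed.

Lemma CdiffD n f g : Cdiff U n f -> Cdiff U n g -> Cdiff U n (f \+ g).
Proof.
elim: n f g => [|n IH] f g [fd fs] [gd gs]; split => //;
  try by move=> x Ux; apply: differentiableD; [exact: fd|exact: gd].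
move=> v; apply: Cdiff_eq_on (IH _ _ (fs v) (gs v)) => x Ux /=.
by rewrite [RHS]deriveD //; apply: diff_derivable; [exact: fd|exact: gd].
Qed.

Lemma CinfD f g : Cinf U f -> Cinf U g -> Cinf U (f \+ g).
Proof. by move=> fs gs n; exact: CdiffD. Qed.

Lemma derive_scale k f x v :
  differentiable k x -> differentiable f x ->
  'D_v (fun y => k y *: f y) x = k x *: 'D_v f x + 'D_v k x *: f x.
Proof.
move=> kx fx; have kfx := is_diff_scale kx fx.
by rewrite !deriveE // diff_val.
Qed.

End Cinf.

Section Cinf_scale.
Context (R : realType) (V W : normedModType R) (U : set V).
Context (oU : open U).

(** By the product rule a derivative is a sum of two products of order [n], the undifferentiated
    factor being lowered by [CdiffS]. *)
Lemma Cdiff_scale n (k : V -> R) (f : V -> W) :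
  Cdiff U n k -> Cdiff U n f -> Cdiff U n (fun x => k x *: f x).
Proof.
elim: n k f => [|n IH] k f /[dup] ks [kd ks'] /[dup] fs [fd fs']; split => //;
  try by move=> x Ux; case: (is_diff_scale (kd x Ux) (fd x Ux)).
move=> v; apply: (@Cdiff_eq_on _ _ _ _ oU _
    ((fun x => k x *: 'D_v f x) \+ (fun x => 'D_v k x *: f x))).
  by move=> x Ux; rewrite [RHS](derive_scale _ (kd x Ux) (fd x Ux)).
by apply: CdiffD => //; apply: IH; by [exact: CdiffS | exact: ks' | exact: fs'].
Qed.

Lemma Cinf_scale (k : V -> R) (f : V -> W) :
  Cinf U k -> Cinf U f -> Cinf U (fun x => k x *: f x).
Proof. by move=> ks fs n; exact: Cdiff_scale. Qed.

Lemma Cinf0 : Cinf U (fun=> 0 : W).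
Proof.
have D0 (v : V) : 'D_v (fun=> 0 : W) = fun=> 0.
  by apply/funext => x; exact: derive_cst.
elim=> [|n IH]; split => //; try by move=> x _; exact: differentiable_cst.
by move=> v; rewrite D0.
Qed.

Lemma Cinf_sum n (f : 'I_n -> V -> W) :
  (forall i, Cinf U (f i)) -> Cinf U (fun x => \sum_(i < n) f i x).
Proof.
elim: n f => [|n IH] f fs.
  by apply: Cinf_eq_on Cinf0 => // x _; rewrite big_ord0.
apply: (@Cinf_eq_on _ _ _ _ oU (f ord0 \+ (fun x => \sum_(i < n) f (lift ord0 i) x))).
  by move=> x _; rewrite big_ord_recl.
by apply: CinfD => //; apply: IH => i; exact: fs.
Qed.

End Cinf_scale.

Lemma derive_coord (R : realType) (V : normedModType R) N (f : V -> 'rV[R]_N) x v j :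
  differentiable f x -> 'D_v (fun y => f y 0 j) x = 'D_v f x 0 j.
Proof. by move=> fx; rewrite derive_mx ?mxE //; exact: diff_derivable. Qed.

Lemma Cinf_coord (R : realType) (V : normedModType R) N (U : set V)
    (f : V -> 'rV[R]_N) j :
  open U -> Cinf U f -> Cinf U (fun y => f y 0 j).
Proof.
move=> oU fs n; move: {fs}(fs n); elim: n f => [|n IH] f [fd fs]; split => //;
  try by move=> x Ux; apply: (@differentiable_comp _ _ _ _ f (fun M : 'rV[R]_N => M 0 j) x (fd x Ux));
    exact: differentiable_coord.
move=> v; apply: Cdiff_eq_on (IH _ (fs v)) => // x Ux.
by rewrite derive_coord //; exact: fd.
Qed.

(** * Time derivatives of the transformed fields *)

(** Pascal's rule in summed form, for the induction step of the Leibniz formula [dtime_dspace]. *)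
Lemma sum_binS (V : nmodType) (u : nat -> V) n :
  \sum_(0 <= k < n.+1) u k *+ 'C(n, k) + \sum_(0 <= k < n.+1) u k.+1 *+ 'C(n, k) =
  \sum_(0 <= k < n.+2) u k *+ 'C(n.+1, k).
Proof.
rewrite big_nat_recl // [RHS]big_nat_recl // !bin0 -addrA; congr (_ + _).
under [RHS]eq_bigr do rewrite binS mulrnDr.
rewrite big_split /=; congr (_ + _).
by rewrite [RHS]big_nat_recr //= bin_small // mulr0n addr0.
Qed.

Section TimeDependent.
Context (R : realType) (N : nat).
Let E : normedModType R := (R * 'rV[R]_N)%type.
Implicit Types (A G : E -> 'rV[R]_N) (p : E) (U : set E).

Definition dtime (n : nat) (G : E -> 'rV[R]_N) : E -> 'rV[R]_N :=
  iter n (fun F => 'D_((1, 0) : E) F) G.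

(** The expression [D_xi G . A], whose direction moves with the base point. *)
Definition dspace (A G : E -> 'rV[R]_N) : E -> 'rV[R]_N :=
  fun p => 'D_((0, A p) : E) G p.

(** These are the [G i] of the overview: the successive total derivatives of [H] along the flow of
    [(1, H)]. *)
Fixpoint flow_deriv (H : E -> 'rV[R]_N) (i : nat) : E -> 'rV[R]_N :=
  if i is j.+1 then
    dtime 1 (flow_deriv H j) \+ dspace H (flow_deriv H j)
  else H.

Let e (j : 'I_N) : E := (0, delta_mx 0 j).

(* Reduces [dspace] to fixed directions, for which [derive_swap] applies. *)
Lemma dspace_sum A G p :
  differentiable G p -> dspace A G p = \sum_(j < N) A p 0 j *: 'D_(e j) G p.
Proof.
move=> Gp; rewrite /dspace deriveE //.
have -> : (0, A p) = \sum_(j < N) A p 0 j *: e j :> E.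
  pose inr v : E := (0, v).
  have inrD : {morph inr : u v / u + v} by move=> u v; rewrite /inr -[RHS]/(0 + 0, u + v) addr0.
  rewrite -/(inr _) [in LHS](row_sum_delta (A p)) (big_morph inr inrD (erefl (inr 0))).
  apply: eq_bigr => j _.
  by rewrite /inr -[RHS]/(A p 0 j *: 0, _) scaler0.
by rewrite linear_sum; apply: eq_bigr => j _; rewrite linearZ deriveE.
Qed.

Lemma Cinf_dspace U A G : open U -> Cinf U A -> Cinf U G -> Cinf U (dspace A G).
Proof.
move=> oU As Gs.
apply: (@Cinf_eq_on _ _ _ _ oU (fun p => \sum_(j < N) A p 0 j *: 'D_(e j) G p)).
  by move=> p Up; rewrite dspace_sum //; exact: Cinf_diff Up.
apply: Cinf_sum => // j; apply: Cinf_scale => //; first exact: Cinf_coord.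
exact: Cinf_derive.
Qed.

(** After expansion over the fixed directions [e j], the product rule applies to each term, and
    [derive_swap] moves [v] inside ['D_(e j)]. *)
Lemma derive_dspace U A G p (v : E) : open U -> U p -> Cinf U A -> Cinf U G ->
  'D_v (dspace A G) p = dspace ('D_v A) G p + dspace A ('D_v G) p.
Proof.
move=> oU Up As Gs.
have Gd q : U q -> differentiable G q by exact: Cinf_diff.
have Dd w q : U q -> differentiable ('D_w G) q by apply/Cinf_diff/Cinf_derive.
rewrite (derive_eq_on _ oU Up (g := fun p => \sum_(j < N) A p 0 j *: 'D_(e j) G p)); last first.
  by move=> q Uq; rewrite dspace_sum //; exact: Gd.
rewrite !dspace_sum //; try by [exact: Gd|exact: Dd].
have Ad j : differentiable (fun q => A q 0 j) p by apply: Cinf_diff Up; exact: Cinf_coord.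
rewrite -big_split /=.
have -> : (fun q => \sum_(j < N) A q 0 j *: 'D_(e j) G q) =
    \sum_(j < N) (fun q => A q 0 j *: 'D_(e j) G q).
  by apply/funext => q; rewrite fct_sumE.
rewrite derive_sum; last first.
  move=> j; apply: diff_derivable.
  by case: (is_diff_scale (Ad j) (Dd (e j) p Up)).
apply: eq_bigr => j _.
rewrite (derive_scale v (Ad j) (Dd (e j) p Up)).
rewrite derive_coord; last exact: Cinf_diff Up.
have swap := derive_swap oU Up Gd (Dd (e j) p Up) (Dd v p Up).
apply: etrans (addrC _ _) _.
exact (congr1 (fun z => 'D_v A p 0 j *: 'D_(e j) G p + A p 0 j *: z) swap).
Qed.

Lemma dtime_eq_on U n G1 G2 p : open U -> U p -> (forall q, U q -> G1 q = G2 q) ->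
  dtime n G1 p = dtime n G2 p.
Proof.
move=> oU + G12; elim: n p => [|n IH] p Up /=; first exact: G12.
exact: (derive_eq_on _ oU Up).
Qed.

Lemma Cinf_dtime U n G : Cinf U G -> Cinf U (dtime n G).
Proof. by move=> Gs; elim: n => //= n; exact: Cinf_derive. Qed.

Lemma dtimeD U n G1 G2 p : open U -> U p -> Cinf U G1 -> Cinf U G2 ->
  dtime n (G1 \+ G2) p = dtime n G1 p + dtime n G2 p.
Proof.
move=> oU + s1 s2; elim: n p => [|n IH] p Up //=.
rewrite (derive_eq_on _ oU Up IH) [LHS]deriveD //;
  by apply: diff_derivable; apply: Cinf_diff Up; exact: Cinf_dtime.
Qed.

Lemma dtimeSr n G : dtime n.+1 G = dtime n (dtime 1 G).
Proof. exact: iterSr. Qed.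

(** Induction with [A] and [G] general: the innermost time derivative is distributed first, so the
    hypothesis applies to [(dtime 1 A, G)] and [(A, dtime 1 G)]. *)
Lemma dtime_dspace U n A G p : open U -> U p -> Cinf U A -> Cinf U G ->
  dtime n (dspace A G) p =
  \sum_(0 <= k < n.+1) dspace (dtime (n - k) A) (dtime k G) p *+ 'C(n, k).
Proof.
move=> oU Up; elim: n A G => [|n IH] A G As Gs.
  by rewrite big_nat1 bin0 mulr1n.
have dAs : Cinf U (dtime 1 A) by exact: Cinf_dtime.
have dGs : Cinf U (dtime 1 G) by exact: Cinf_dtime.
rewrite dtimeSr.
rewrite (dtime_eq_on n oU Up (G2 := dspace (dtime 1 A) G \+ dspace A (dtime 1 G))); last first.
  by move=> q Uq; exact: (derive_dspace _ oU Uq).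
rewrite (dtimeD n oU Up); [|exact: Cinf_dspace..].
rewrite !IH //.
rewrite -(sum_binS (fun k => dspace (dtime (n.+1 - k) A) (dtime k G) p)).
apply: (f_equal2 +%R).
  apply: eq_big_nat => k /andP[_ kn].
  by rewrite (subSn (kn : (k <= n)%N)) (dtimeSr (n - k) A).
by apply: eq_bigr => k _; rewrite subSS (dtimeSr k G).
Qed.

Lemma Cinf_flow_deriv U H i : open U -> Cinf U H -> Cinf U (flow_deriv H i).
Proof.
move=> oU Hs; elim: i => //= i IH; apply: CinfD => //.
  exact: Cinf_derive.
exact: Cinf_dspace.
Qed.

(** At each stage both difference quotients are the same function of [h], so their limits agree
    without any differentiability assumption. *)
Lemma derive1n_dtime G (xi : 'rV[R]_N) n :
  derive1n n (fun tau => G (tau, xi)) = fun tau => dtime n G (tau, xi).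
Proof.
elim: n => [//|n IH]; rewrite derive1nS IH; apply/funext => tau.
rewrite /derive1 /= /derive; congr (lim _).
rewrite (_ : (fun h : R => h^-1 *: (dtime n G (h + tau, xi) - dtime n G (tau, xi))) =
   (fun h : R => h^-1 *: ((dtime n G \o shift (tau, xi)) (h *: (1, 0)) - dtime n G (tau, xi)))) //.
apply/funext => h; congr (_ *: (dtime n G _ - _)).
by rewrite -[RHS]/(h *: 1 + tau, h *: 0 + xi) scaler0 add0r scaler1.
Qed.

Lemma derive_slice G (tau : R) (xi w : 'rV[R]_N) :
  'D_w (fun z => G (tau, z)) xi = 'D_((0, w) : E) G (tau, xi).
Proof.
rewrite /derive; congr (lim _).
rewrite (_ : (fun h : R => h^-1 *: (((fun z => G (tau, z)) \o shift xi) (h *: w) - G (tau, xi))) =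
   (fun h : R => h^-1 *: ((G \o shift ((tau, xi) : E)) (h *: ((0, w) : E)) - G (tau, xi)))) //.
apply/funext => h; congr (_ *: (G _ - _)).
by rewrite -[RHS]/(h *: 0 + tau, h *: w + xi) scaler0 add0r.
Qed.

(** Differentiating the recursion for [flow_deriv] [n] times in time gives, by the Leibniz rule, the
    recursion of [Ftrans]. *)
Lemma FtransE (H : R -> 'rV[R]_N -> 'rV[R]_N) (Omega : set 'rV[R]_N) U i n xi :
  open U -> open Omega -> (forall z, Omega z -> U (0, z)) ->
  Cinf U (fun p : E => H p.1 p.2) -> Omega xi ->
  Ftrans (tcoef H) (tcoef H) i n xi =
  dtime n (flow_deriv (fun p : E => H p.1 p.2) i) (0, xi).
Proof.
move=> oU oO OU Hs; set K := fun p : E => H p.1 p.2.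
have tcE m z : tcoef H m z = dtime m K (0, z).
  by rewrite /tcoef (derive1n_dtime K).
elim: i n xi => [|i IH] n xi Oxi; first exact: tcE.
have U0 := OU _ Oxi.
have Fs := Cinf_flow_deriv i oU Hs.
have dFs : Cinf U (dtime 1 (flow_deriv K i)) by exact: Cinf_dtime.
have sFs : Cinf U (dspace K (flow_deriv K i)) by exact: Cinf_dspace.
rewrite -[RHS]/(dtime n (dtime 1 (flow_deriv K i) \+ dspace K (flow_deriv K i)) (0, xi)).
rewrite (dtimeD n oU U0 dFs sFs) [X in _ = _ + X](dtime_dspace n oU U0 Hs Fs).
rewrite -(dtimeSr n (flow_deriv K i)).
rewrite [LHS]/= (IH _ _ Oxi).
apply: (f_equal2 +%R); first by [].
apply: eq_bigr => k _; apply: (congr1 (fun z => z *+ _)).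
(* The induction hypothesis holds on the open set [Omega], hence near [xi], and may be
   differentiated in space there; [tcE] identifies the direction. *)
by rewrite (derive_eq_on _ oO Oxi (IH k)) derive_slice tcE.
Qed.

End TimeDependent.

(** * Expansion of the trajectory *)

Unset Implicit Arguments.

Theorem theorem2p9 (R : realType) (N : nat) (Omega : set 'rV[R]_N)
    (I : interval R) (H : R -> R -> 'rV[R]_N -> 'rV[R]_N) :
  open Omega ->
  (0 : R) \in I ->
  forall t : R, 0 < t ->
  (exists U : set (R * 'rV[R]_N),
     open U /\
     (forall tau xi, tau \in I -> Omega xi -> U (tau, xi)) /\
     smooth_on U (fun p : R * 'rV[R]_N => H t p.1 p.2)) ->
  forall (x : 'rV[R]_N) (xi : R -> 'rV[R]_N),
    Omega x ->
    xi 0 = x ->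
    (forall tau, tau \in I -> Omega (xi tau)) ->
    (forall tau, tau \in I ->
       has_deriv_within [set s | s \in I] xi tau (H t tau (xi tau))) ->
    forall n : nat, forall eps : R, 0 < eps ->
      exists2 delta : R, 0 < delta &
        forall tau, tau \in I -> `|tau| < delta ->
          `| xi tau - Tpartial (tcoef (H t)) (tcoef (H t)) n tau x |
            <= eps * `|tau| ^+ n.
Proof.
move=> oO I0 t _ [U [oU [IOU Hs]]] x xi Ox xi0 Oxi xid n eps e0.
set K := fun p : R * 'rV[R]_N => H t p.1 p.2 in Hs.
have Ks := smooth_on_Cinf Hs.
(* [y i] is the [i]-th derivative of the trajectory; the index of [flow_deriv] is one lower because
   that family starts at [H], the first derivative. *)
pose y i tau := if i is j.+1 then flow_deriv K j (tau, xi tau) else xi tau.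
have yd i tau : tau \in I -> has_deriv_within [set s | s \in I] (y i) tau (y i.+1 tau).
  move=> tauI; case: i => [|i]; first exact: xid.
  have Up := IOU _ _ tauI (Oxi _ tauI).
  have Fd := Cinf_diff (Cinf_flow_deriv i oU Ks) Up.
  have := has_deriv_within_comp (f := fun s => (s, xi s)) Fd
    (has_deriv_within_pair (xid _ tauI)).
  rewrite (_ : 'd _ _ _ = y i.+2 tau) //.
  (* By linearity the differential at [(1, 0) + (0, H)] is the sum of the time and space terms
     defining the next [flow_deriv]. *)
  rewrite /= /dtime /dspace /= !deriveE // -linearD; congr ('d _ _ _).
  by rewrite -[RHS]/(1 + 0, 0 + H t tau (xi tau)) addr0 add0r.
have [delta d0 hd] := taylor_peano_within I0 yd n 0%N e0.
exists delta => // tau tauI taud.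
(* The partial sum is a Taylor polynomial: its term of order 0 is the initial point, and [FtransE]
   with [n = 0] gives the coefficient of order [k.+1]. *)
rewrite (_ : Tpartial _ _ _ _ _ =
  \sum_(k < n.+1) (tau ^+ k / k`!%:R) *: y (0 + k)%N 0); first exact: hd.
rewrite /Tpartial big_ord_recl expr0 fact0 divr1 scale1r /= xi0.
apply: (f_equal2 +%R); first by [].
apply: eq_bigr => k _; rewrite /= /bump /= add1n.
by rewrite (FtransE _ _ oU oO (fun z => IOU 0 z I0) Ks Ox).
Qed.
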